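(* Let $\lambda=[\lambda_1,\ldots,\lambda_r]$ be a nonempty partition distinct from $[1]$. Then $\lambda$ is a losing position ($\mathcal P$-position) of the game Rook under normal play if and only if $\lambda$ has rank $0$ and $\lambda[1,1]\ge \mathrm{Stair}^{r-1}$.
   Context: A partition is a finite weakly decreasing sequence $\lambda=[\lambda_1,\ldots,\lambda_r]$ of positive integers ($r\ge 0$; $[\,]$ is the empty partition). For $i,j\ge 0$ the subpartition $\lambda[i,j]$ is $[\lambda_{i+1}-j,\lambda_{i+2}-j,\ldots]$ with trailing nonpositive entries removed (delete the first $i$ rows and first $j$ columns of the Young diagram). Order (Young lattice): $[\lambda_1,\ldots,\lambda_r]\le[\beta_1,\ldots,\beta_m]$ iff $r\le m$ and $\lambda_i\le\beta_i$ for all $i\le r$. The rank of $\lambda=[\lambda_1,\dots,\lambda_r]$ is $|\lambda_1-r|$. The staircase is $\mathrm{Stair}^{k}=[k,k-1,\ldots,1]$ for $k \geq 1$ ($\mathrm{Stair}^0=[\,]$). Rook is the two-player impartial game whose positions are nonempty partitions; from $\lambda$ a player may move to $\lambda[i,j]$ for any $(i,j)\in\{(k,0):k\ge1\}\cup\{(0,k):k\ge1\}$ such that $\lambda[i,j]\neq[\,]$. Normal play: the player who cannot move loses. A position is losing ($\mathcal P$) if no move from it leads to a $\mathcal P$-position (in particular terminal positions are $\mathcal P$); otherwise it is winning ($\mathcal N$). *)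

(* Defs.v *)
From HB Require Import structures.
From mathcomp Require Import all_boot ssrint.

Set Implicit Arguments.
Unset Strict Implicit.
Unset Printing Implicit Defensive.

Definition is_partition (s : seq nat) : bool := sorted geq s && all (leq 1) s.

Record partition := Partition {
  parts :> seq nat;
  partsP : is_partition parts
}.

HB.instance Definition _ := [isSub for parts].
HB.instance Definition _ := [Equality of partition by <:].

(* Truncated subtraction sends the nonpositive entries to 0; since the entries
   decrease, filtering the zeros out removes exactly a tail. *)
Definition sub_seq (s : seq nat) (i j : nat) : seq nat :=
  [seq y <- [seq x - j | x <- drop i s] | 0 < y].

Lemma sub_seqP (l : partition) (i j : nat) : is_partition (sub_seq l i j).
Proof.
case: l => s /= /andP[ss _]; apply/andP; split; last exact: filter_all.
have geq_tr : transitive geq by move=> y x z /= xy yz; apply: leq_trans yz xy.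
apply: sorted_filter => //.
apply: (homo_sorted (e := geq)) => [x y /= xy|]; first exact: leq_sub2r.
exact: drop_sorted.
Qed.

Definition subpartition (l : partition) (i j : nat) : partition :=
  Partition (sub_seqP l i j).

Lemma stairP (k : nat) : is_partition (rev (iota 1 k)).
Proof.
apply/andP; split; first by rewrite rev_sorted; exact: iota_sorted.
by rewrite all_rev; apply/allP => x; rewrite mem_iota => /andP[].
Qed.

Definition Stair (k : nat) : partition := Partition (stairP k).

Definition young_le (l m : partition) : Prop :=
  size l <= size m /\ forall i, i < size l -> nth 0 l i <= nth 0 m i.

(* [`|m - n|] is the distance |m - n|, not the truncated difference. *)
Definition rank (l : partition) : nat := `|head 0 l - size l|%N.

Definition P_position (T : Type) (move : T -> T -> Prop)
    (move_wf : well_founded (fun y x => move x y)) : T -> Prop :=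
  Fix move_wf (fun _ => Prop)
    (fun x losing => forall y (xy : move x y), ~ losing y xy).

Lemma P_positionE (T : Type) (move : T -> T -> Prop)
    (move_wf : well_founded (fun y x => move x y)) (x : T) :
  P_position move_wf x <-> forall y, move x y -> ~ P_position move_wf y.
Proof.
rewrite /P_position /Fix; set F := (F in Fix_F _ F _).
have irr : forall z (a b : Acc (fun y x => move x y) z),
    Fix_F (fun _ => Prop) F a <-> Fix_F (fun _ => Prop) F b.
  move=> z; elim: z / (move_wf z) => z _ IH [a] [b] /=.
  by split=> H y zy Hy; apply: (H y zy); case: (IH y zy (a y zy) (b y zy)); auto.
case: (move_wf x) => a /=; split=> H y xy Hy; apply: (H y xy);
  by case: (irr y (a y xy) (move_wf y)); auto.
Qed.

Record position := Position {
  shape :> partition;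
  shape_neq0 : shape != [::] :> seq nat
}.

(* The condition that the new partition is nonempty is carried by the type of
   [q]. *)
Definition rook_move (p q : position) : Prop :=
  exists k, 1 <= k /\
    (shape q = subpartition p k 0 \/ shape q = subpartition p 0 k).

Lemma sumn_sub_seq (s : seq nat) (i j : nat) :
  sumn (sub_seq s i j) + j * size (sub_seq s i j) <= sumn s.
Proof.
rewrite -[s in leqRHS](cat_take_drop i) sumn_cat /sub_seq.
apply: leq_trans (leq_addl _ _).
elim: (drop i s) => [|x t IH] /=; first by rewrite muln0.
case: ifP => [xj|_]; last exact: leq_trans IH (leq_addl _ _).
by rewrite /= mulnS addnACA leq_add // subnK // ltnW // -subn_gt0.
Qed.

Lemma size_sub_seq (s : seq nat) (i j : nat) :
  size (sub_seq s i j) <= size s - i.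
Proof.
by rewrite -size_drop size_filter (leq_trans (count_size _ _)) // size_map.
Qed.

Lemma rook_wf : well_founded (fun q p => rook_move p q).
Proof.
pose f (p : position) := size p + sumn p.
have f_lt p q : rook_move p q -> f q < f p.
  case=> k [k0 qE].
  have : 0 < size q by rewrite lt0n size_eq0 shape_neq0.
  rewrite /f; case: qE => -> /= q0.
    have := size_sub_seq p k 0; have := sumn_sub_seq p k 0.
    rewrite mul0n addn0 => Hs Hz; rewrite -addSn leq_add //.
    apply: leq_ltn_trans Hz _; rewrite ltn_subrL k0 /=.
    by move: (shape_neq0 p); rewrite -size_eq0 lt0n.
  have := size_sub_seq p 0 k; have := sumn_sub_seq p 0 k.
  rewrite subn0 => Hs Hz; rewrite -addnS leq_add //.
  by apply: leq_trans Hs; rewrite -[X in X < _]addn0 ltn_add2l muln_gt0 k0.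
have acc n : forall p, f p < n -> Acc (fun q p => rook_move p q) p.
  elim: n => [p|n IH p]; first by rewrite ltn0.
  move=> pn; constructor=> q /f_lt qp; apply: IH; exact: leq_trans qp pn.
move=> p; exact: (acc (f p).+1 p (leqnn _)).
Qed.

Definition rook_losing : position -> Prop := P_position rook_wf.

(* Main.v *)
Require Import Defs.
From mathcomp Require Import all_boot.
From mathcomp Require Import zify.

(* Gives [partition] back the meaning that [finset] overrides. *)
Import Defs.

(** Write [r] for the number of rows. The condition of the theorem says that the
    first row has length [r] and that deleting [0 < i < r] rows always leaves a
    shape wider than it is tall; then every proper column deletion leaves a
    shape taller than it is wide, so no move stays in the class. Conversely, if
    the first row has length at most [r], delete the largest number of rows
    leaving a shape that is not wider than tall: by maximality, and since
    deleting one row lowers the height by exactly one without increasing the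
    width, that shape is in the class. If the first row is longer than [r],
    argue with columns. *)

(** By well-founded induction, a move graph has at most one kernel, that is, one set of positions
    both independent and absorbing. *)
Lemma P_position_kernel (T : Type) (move : T -> T -> Prop)
    (move_wf : well_founded (fun y x => move x y)) (K : T -> Prop) :
    (forall x y, move x y -> K x -> ~ K y) ->
    (forall x, K x \/ exists2 y, move x y & K y) ->
  forall x, P_position move_wf x <-> K x.
Proof.
move=> Kstable Kabsorb x; elim: x / (move_wf x) => x _ IH.
rewrite P_positionE; split=> [noK | Kx y xy /(IH _ xy)]; last exact: Kstable Kx.
by case: (Kabsorb x) => // -[y xy /(IH _ xy)/(noK _ xy)].
Qed.

Lemma eq_from_ltn (m n : nat) : (forall i, (i < m) = (i < n)) -> m = n.
Proof. by move=> eq_mn; have := eq_mn m; have := eq_mn n; lia. Qed.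

(** In a decreasing sequence only zeros follow a zero, so the filter cuts off a tail, and the
    default value 0 stands in for it. *)
Lemma nth_filter_gt0 (s : seq nat) (n : nat) :
  sorted geq s -> nth 0 [seq y <- s | 0 < y] n = nth 0 s n.
Proof.
elim: s n => //= x s IH n xs; have /IH {}IH := path_sorted xs.
case: posnP xs => [-> s0 | _ _]; last by case: n.
have {s0} : all (geq 0) s.
  by apply: order_path_min s0 => y x' z /= xy yz; apply: leq_trans yz xy.
move=> /allP s0.
rewrite (@eq_in_filter _ _ pred0) => [|y /s0 /=]; last by rewrite lt0n leqn0 => ->.
rewrite filter_pred0 nth_nil; case: n => //= n.
have [/(mem_nth 0)/s0 | ge_n] := ltnP n (size s); last by rewrite nth_default.
by rewrite /= leqn0 => /eqP.
Qed.

Lemma nth_subpartition (l : partition) (i j n : nat) :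
  nth 0 (subpartition l i j) n = nth 0 l (i + n) - j.
Proof.
rewrite /= nth_filter_gt0 => [|].
  have [lt_n | ge_n] := ltnP n (size (drop i l)).
    by rewrite (nth_map 0) // nth_drop.
  by rewrite nth_default ?size_map // -nth_drop nth_default.
apply: (homo_sorted (e := geq)) => [x y /= xy|]; first exact: leq_sub2r.
by apply: drop_sorted; case: l => s /= /andP[].
Qed.

Lemma ltn_size_partition (l : partition) (n : nat) :
  (n < size l) = (0 < nth 0 l n).
Proof.
have [lt_n | ge_n] := ltnP n (size l); last by rewrite nth_default.
by case: l lt_n => s /= /andP[_ /allP s_gt0] lt_n; rewrite s_gt0 ?mem_nth.
Qed.

Lemma nth_partition_le (l : partition) (m n : nat) :
  m <= n -> nth 0 l n <= nth 0 l m.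
Proof.
move=> le_mn; have [lt_n | ge_n] := ltnP n (size l); last by rewrite nth_default.
have geq_tr : transitive geq by move=> y x z /= xy yz; apply: leq_trans yz xy.
case: l lt_n => s /= /andP[s_sorted _] lt_n.
by apply: (sorted_leq_nth geq_tr leqnn 0 s_sorted); rewrite ?inE //; lia.
Qed.

(** For [i = 0] the size is the length of column [j], counted from 0; this is the rule that
    exchanges rows and columns. *)
Lemma ltn_size_subpartition (l : partition) (i j n : nat) :
  (n < size (subpartition l i j)) = (j < nth 0 l (i + n)).
Proof. by rewrite ltn_size_partition nth_subpartition subn_gt0. Qed.

Lemma size_subpartition_row (l : partition) (i : nat) :
  size (subpartition l i 0) = size l - i.
Proof.
apply: eq_from_ltn => n; rewrite ltn_size_subpartition -ltn_size_partition.
by lia.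
Qed.

Definition balanced (l : partition) : Prop :=
  nth 0 l 0 = size l /\ forall i, 0 < i < size l -> size l - i < nth 0 l i.

(** Row [i] of the staircase has [size l - i.+1] cells and row [i] of [subpartition l 1 1] is row
    [i.+1] of [l] less one cell, which turns the weak inequality into the strict one at [i.+1]. *)
Lemma balancedP (l : partition) :
  balanced l <->
  rank l = 0 /\ young_le (Stair (size l).-1) (subpartition l 1 1).
Proof.
have nth_stair k i : i < k -> nth 0 (Stair k) i = k - i.
  by move=> lt_ik; rewrite /= nth_rev size_iota // nth_iota; lia.
have size_stair k : size (Stair k) = k by rewrite /= size_rev size_iota.
rewrite /rank -nth0 /balanced /young_le size_stair.
split=> [[-> wide] | [rank0 [_ le_stair]]].
  split; first by lia.
  split=> [|i lt_i].
    (* If there are at least two rows, the last has at least two cells, so deleting a row and a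
       column leaves [(size l).-1] rows. *)
    case size_l: (size l).-1 => [//|k].
    by rewrite ltn_size_subpartition; have := wide k.+1; rewrite add1n; lia.
  by rewrite nth_stair // nth_subpartition add1n; have := wide i.+1; lia.
split=> [|[//|i] lt_i]; first by lia.
have := le_stair i; rewrite nth_stair ?nth_subpartition ?add1n; last by lia.
by lia.
Qed.

Lemma balanced_rook_move (p q : position) :
  rook_move p q -> balanced p -> ~ balanced q.
Proof.
have := shape_neq0 q; rewrite -size_eq0 -lt0n => q_gt0.
case=> k [k_gt0 qE] [sq_p wide_p] [sq_q _].
case: qE => qE; move: sq_q q_gt0; rewrite qE nth_subpartition.
  by rewrite size_subpartition_row; have := wide_p k; rewrite addn0; lia.
rewrite ltn_size_subpartition addn0 => sq_q lt_k.
(* Row [size p - k] has more than [k] cells, so more than [size p - k] rows survive. *)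
have := ltn_size_subpartition p 0 k (size p - k).
by rewrite -sq_q add0n; have := wide_p (size p - k); lia.
Qed.

Lemma rook_move_balanced (p : position) :
  balanced p \/ exists2 q, rook_move p q & balanced q.
Proof.
have p_gt0 : 0 < size p by have := shape_neq0 p; rewrite -size_eq0 -lt0n.
have move_to l k : 0 < k -> l = subpartition p k 0 \/ l = subpartition p 0 k ->
    0 < size l -> balanced l -> exists2 q, rook_move p q & balanced q.
  move=> k_gt0 lE; rewrite lt0n size_eq0 => l_neq0 l_bal.
  by exists (Position l_neq0) => //; exists k.
have [le_r | gt_r] := leqP (nth 0 p 0) (size p).
  pose narrow k := (k < size p) && (nth 0 p k <= size p - k).
  have ex_narrow : exists k, narrow k by exists 0; rewrite /narrow; lia.
  have ub_narrow k : narrow k -> k <= size p by case/andP=> /ltnW.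
  case: (ex_maxnP ex_narrow ub_narrow) => k /andP[lt_k le_k] max_k.
  have wide i : k < i < size p -> size p - i < nth 0 p i.
    by have := max_k i; rewrite /narrow; lia.
  have sq_k : nth 0 p k = size p - k.
    (* Were row [k] shorter, [k.+1] would be narrow too, unless row [k] is the last; but that row is
       nonempty. *)
    have := ltn_size_partition p k; have := nth_partition_le p _ _ (leqnSn k).
    by have := wide k.+1; lia.
  have [k0 | k_gt0] := posnP k.
    by left; rewrite k0 subn0 in sq_k wide.
  right; apply: (@move_to (subpartition p k 0) k) => //; first by left.
    by rewrite size_subpartition_row; lia.
  rewrite /balanced size_subpartition_row; split=> [|i lt_i].
    by rewrite nth_subpartition addn0; lia.
  by rewrite nth_subpartition; have := wide (k + i); lia.
right; pose m k := size (subpartition p 0 k).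
have ltn_m n k : (n < m k) = (k < nth 0 p n) by apply: ltn_size_subpartition.
pose short k := (k < nth 0 p 0) && (m k <= nth 0 p 0 - k).
have m0 : m 0 = size p.
  by rewrite /m size_subpartition_row subn0.
have ex_short : exists k, short k by exists 0; rewrite /short; lia.
have ub_short k : short k -> k <= nth 0 p 0 by case/andP=> /ltnW.
case: (ex_maxnP ex_short ub_short) => k /andP[lt_k le_k] max_k.
have tall i : k < i < nth 0 p 0 -> nth 0 p 0 - i < m i.
  by have := max_k i; rewrite /short; lia.
have sq_k : m k = nth 0 p 0 - k.
  (* If [m k] were smaller, row [nth 0 p 0 - k.+1] would have at most [k] cells, so [k.+1] would be
     short too; if column [k] is the last, it is nonempty. *)
  have := ltn_m 0 k; have := ltn_m (nth 0 p 0 - k.+1) k.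
  have := ltn_m (nth 0 p 0 - k.+1) k.+1; have := tall k.+1.
  by lia.
have k_gt0 : 0 < k by rewrite lt0n; apply/eqP => k0; move: sq_k; rewrite k0 m0; lia.
apply: (@move_to (subpartition p 0 k) k) => //; first by right.
  by rewrite -/(m k); lia.
rewrite /balanced -/(m k); split=> [|i lt_i].
  by rewrite nth_subpartition.
rewrite nth_subpartition add0n.
(* Column [nth 0 p 0 - i] has more than [i] cells, hence row [i] has more than [nth 0 p 0 - i]. *)
by have := ltn_m i (nth 0 p 0 - i); have := tall (nth 0 p 0 - i); lia.
Qed.

Theorem theorem3p16 (lambda : position) (neq1 : lambda != [:: 1] :> seq nat) :
  rook_losing lambda <->
  rank lambda = 0 /\ young_le (Stair (size lambda).-1) (subpartition lambda 1 1).
Proof.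
rewrite -balancedP; apply: (P_position_kernel _ _ rook_wf (fun p => balanced (shape p))).
  exact: balanced_rook_move.
exact: rook_move_balanced.
Qed.
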